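(* Let $D$ be a finite source-free bipartite digraph with bipartition $U\cup V$. If $q,\ell\ge 3$ are integers such that $\ell\le (q+3)/2$ and such that every directed cycle of $D$ has length at least $\ell$, then $D$ contains a $q$-kernel $Q$ with $|Q|\le\frac{1}{\ell}|V(D)|$ and $Q\subseteq U$.
   Context: A digraph is source-free if every vertex has in-degree at least $1$. A partition $U,V$ of $V(D)$ is a bipartition if every arc has exactly one endpoint in $U$ and one in $V$. A set of vertices is independent if there are no arcs between two of its vertices. $\mathrm{dist}(S,v)$ is the minimum over $u\in S$ of the length of a shortest directed path from $u$ to $v$. A $q$-kernel is an independent set $Q$ with $\mathrm{dist}(Q,v)\le q$ for all $v\in V(D)$. *)

(* Defs.v *)
From mathcomp Require Import all_boot.

Set Implicit Arguments.
Unset Strict Implicit.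
Unset Printing Implicit Defensive.

(* A finite digraph is a finType T of vertices with an arc relation e;
   e x y is an arc from x to y. *)
Section Digraph.

Variables (T : finType) (e : rel T).

Definition source_free : Prop := forall v : T, exists u : T, e u v.

(* Either part may be empty. *)
Definition bipartition (U V : {set T}) : Prop :=
  [/\ U :|: V = [set: T],
      [disjoint U & V] &
      forall x y : T, e x y ->
        (x \in U /\ y \in V) \/ (x \in V /\ y \in U)].

(* path.cycle allows the empty sequence, which is not a directed cycle; the
   length of c is size c (a loop is a cycle of length 1). *)
Definition dicycle (c : seq T) : Prop := c <> [::] /\ ucycle e c.

Definition independent (S : {set T}) : Prop :=
  forall x y : T, x \in S -> y \in S -> ~~ e x y.

(* x :: p is a directed path from x to y; its length is size p. *)
Definition dipath (x y : T) (p : seq T) : Prop :=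
  [/\ path e x p, last x p = y & uniq (x :: p)].

(* Distances are relations, so that an infinite distance is one for which no
   natural number d qualifies. *)
Definition is_dist (x y : T) (d : nat) : Prop :=
  (exists2 p, dipath x y p & size p = d) /\
  (forall p, dipath x y p -> d <= size p).

Definition is_set_dist (S : {set T}) (v : T) (d : nat) : Prop :=
  (exists2 u, u \in S & is_dist u v d) /\
  (forall u k, u \in S -> is_dist u v k -> d <= k).

Definition q_kernel (q : nat) (Q : {set T}) : Prop :=
  independent Q /\
  forall v : T, exists2 d, is_set_dist Q v d & d <= q.

End Digraph.

(* Main.v *)
(** Fix an in-neighbour [f v] of every vertex [v].  It suffices to find a small
    [Q] in [U] that every vertex reaches by at most [q] iterations of [f]; the
    graph of [f] consists of cycles, of even length at least [l], with trees
    attached.  A deepest tree vertex at distance more than [l] from its cycle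
    (or [l], if its tree is attached at a vertex of [V]) has an ancestor in [U]
    at distance [l - 1] or [l]; put that ancestor in [Q] and delete its at least
    [l] descendants, all of which it dominates.  Once this is impossible, treat
    a whole component, with [n] vertices: group the cycle vertices into
    consecutive pairs [(V, U)], weighted by the sizes of the attached trees,
    and walk backwards along the cycle.  Select the last pair, and each pair
    where the accumulated weight passes a multiple [j * l] with [j < n %/ l].
    An unselected pair is separated from the next selected one by weight at most
    [2 * l - 4], hence is at distance at most [2 * l - 3 <= q] from it, provided
    that the walk ends with a pair of weight at least 3, or that there are no
    trees at all and the weight in question is even. *)
Require Import Defs.
From mathcomp Require Import all_boot zify.

Set Implicit Arguments.
Unset Strict Implicit.
Unset Printing Implicit Defensive.

(** * Selection of pairs by accumulated weight *)

(* [R p] is the total weight of the first [p] pairs. *)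
Lemma block_selection (l m : nat) (R : nat -> nat) :
  3 <= l -> 0 < m -> {homo R : i j / i <= j} -> l <= R m ->
  R m.-1 + 3 <= R m \/ (forall i, i <= m -> R i = i.*2) ->
  exists2 P : {set 'I_m}, l * #|P| <= R m &
    forall p, p < m -> exists2 p' : 'I_m, p' \in P &
      p <= p' /\ (p = p' \/ R p' - R p <= 2 * l - 4).
Proof.
case: m => // m l3 _ Rmono lR last_heavy.
have [D DE] : exists D, forall i, R i %/ l = D i by eexists.
have D_homo : {homo D : i j / i <= j} by move=> i j ij; rewrite -!DE leq_div2r ?Rmono.
have [k kE] : exists k, D m.+1 = k.+1.
  by exists (D m.+1).-1; rewrite prednK // -DE divn_gt0 //; lia.
(* The cap [k] ignores crossings that start at quotient [k] or above, which frees the slot [k] for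
   the last pair: at most [k.+1] picks. *)
pose picked p := (p == m) || (D p < minn (D p.+1) k).
exists [set p : 'I_m.+1 | picked p].
  suff le_k : #|[set p : 'I_m.+1 | picked p]| <= k.+1.
    apply: leq_trans (leq_trunc_div (R m.+1) l).
    by rewrite mulnC leq_mul2r DE kE le_k orbT.
  pose slot (p : 'I_m.+1) : 'I_k.+1 := inord (if p == m :> nat then k else D p).
  have slot_lt (p : nat) : picked p -> (if p == m then k else D p) < k.+1.
    by rewrite /picked; case: eqP => //= _; lia.
  rewrite -[X in _ <= X]card_ord; apply: (leq_card_in slot) => p p'.
  have := D_homo p.+1 p'; have := D_homo p'.+1 p.
  have := ltn_ord p; have := ltn_ord p'; rewrite !inE.
  move=> p'm pm sep1 sep2 hp hp' /(congr1 val); rewrite /= !inordK ?slot_lt // => E.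
  by apply/val_inj => /=; move: hp hp' E; rewrite /picked; do 2!case: eqP => ? /=; lia.
move=> p pm.
have [p' /andP[pp' pick'] minp'] :
    {p' | (p <= p') && picked p' & forall j, (p <= j) && picked j -> p' <= j}.
  have ex : exists p', (p <= p') && picked p' by exists m; rewrite /picked eqxx; lia.
  by case: (ex_minnP ex) => p' ? ?; exists p'.
have p'm : p' < m.+1 by rewrite ltnS; apply: minp'; rewrite /picked eqxx; lia.
exists (Ordinal p'm); rewrite ?inE //=; split=> //.
case: (eqVneq p p') => [|npp']; [by left | right].
have unpicked j : p <= j -> j < p' -> ~~ picked j.
  by move=> pj; apply: contraTN => pickj; rewrite -leqNgt minp' ?pj.
have gap_le a b : a %/ l = b %/ l -> a - b <= l - 1.
  move=> E; have := divn_eq a l; have := divn_eq b l.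
  have : a %% l < l by rewrite ltn_mod; lia.
  rewrite E; lia.
(* Below level [k], unpicked pairs leave the quotient unchanged, so the gap is at most [l - 1],
   hence at most [2 * l - 4]. *)
case: (ltnP (D p) k) => Dpk.
  suff same j : p + j <= p' -> D (p + j) = D p.
    by have := gap_le (R p') (R p); rewrite !DE -(same (p' - p)) ?subnKC //; lia.
  elim: j => [|j IHj] hj; first by rewrite addn0.
  have := unpicked (p + j); rewrite /picked addnS in hj *.
  by have := D_homo _ _ (leqnSn (p + j)); lia.
(* Here [k * l <= R p] while [R m.+1 < (k + 2) * l]. A last pair of weight 3 brings [R m - R p] down
   to [2 * l - 4]; weights all 2 give [2 * l - 3], and parity removes the last unit. *)
have := divn_eq (R m.+1) l; rewrite DE kE mulSn.
have : R m.+1 %% l < l by rewrite ltn_mod; lia.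
have : k * l <= R p by rewrite -leq_divRL ?DE //; lia.
have := Rmono p' m p'm.
by case: last_heavy => [|dbl] /=; rewrite ?dbl //; lia.
Qed.

(** * Cycles and hanging trees of a functional graph *)

Section FunctionalGraph.

Variables (T : finType) (f : T -> T).

(** This is item 2, counting from 0, of the equivalences in [orbitPcycle], which supplies the other
    forms. *)
Definition cyclic (x : T) : bool := fconnect f (f x) x.

Lemma cyclicP x : reflect (exists k, iter k.+1 f x = x) (cyclic x).
Proof. exact/(equivP idP)/(orbitPcycle 2 3). Qed.

Lemma iter_order_cyclic x : cyclic x -> iter (order f x) f x = x.
Proof. exact: (orbitPcycle 2 4).1. Qed.

Lemma order_step_cyclic x : cyclic x -> order f (f x) = order f x.
Proof. exact: (orbitPcycle 2 1).1. Qed.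

Lemma cyclic_step x : cyclic x -> cyclic (f x).
Proof.
by case/cyclicP=> k fk; apply/cyclicP; exists k; rewrite -iterSr iterS fk.
Qed.

Lemma cyclic_iter i x : cyclic x -> cyclic (iter i f x).
Proof. by move=> cx; elim: i => //= i; apply: cyclic_step. Qed.

Lemma fconnect_cyclic_sym x y : cyclic x -> fconnect f x y -> fconnect f y x.
Proof.
move=> /((orbitPcycle 2 0).1) fc; rewrite fconnect_orbit => yx.
by rewrite (fconnect_cycle fc yx) -fconnect_orbit connect0.
Qed.

Lemma eventually_cyclic x : exists i, cyclic (iter i f x).
Proof.
have /loopingP/(_ (order f x))/trajectP[j lt_j fj] := looping_order f x.
exists j; apply/cyclicP; exists (order f x - j).-1.
by rewrite prednK ?subn_gt0 // -iterD subnK // ltnW.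
Qed.

(** Height of [x] above its cycle; [entry x] is the root of the hanging tree containing [x]. *)
Definition depth (x : T) : nat := ex_minn (eventually_cyclic x).

Definition entry (x : T) : T := iter (depth x) f x.

Lemma entry_cyclic x : cyclic (entry x).
Proof. by rewrite /entry /depth; case: ex_minnP. Qed.

Lemma depth_min i x : cyclic (iter i f x) -> depth x <= i.
Proof. by rewrite /depth; case: ex_minnP => m _ min_m /min_m. Qed.

Lemma depth_eq0 x : (depth x == 0) = cyclic x.
Proof.
apply/eqP/idP => [d0|cx]; first by have := entry_cyclic x; rewrite /entry d0.
by apply/eqP; rewrite -leqn0 (@depth_min 0).
Qed.

Lemma depth_step x : depth (f x) = (depth x).-1.
Proof.
apply/eqP; rewrite eqn_leq; apply/andP; split.
  apply: depth_min; rewrite -iterSr.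
  case: (posnP (depth x)) => [d0 | d_gt0].
    by rewrite d0 /= cyclic_step // -depth_eq0 d0.
  by rewrite prednK // entry_cyclic.
suff : depth x <= (depth (f x)).+1 by lia.
by apply: depth_min; rewrite iterSr entry_cyclic.
Qed.

Lemma depth_iter i x : depth (iter i f x) = depth x - i.
Proof. by elim: i => [|i IHi]; rewrite ?subn0 //= depth_step IHi; lia. Qed.

Lemma entry_iter i x : i <= depth x -> entry (iter i f x) = entry x.
Proof. by move=> le_i; rewrite /entry depth_iter -iterD subnK. Qed.

(** Depth drops by one at each step until the cycle is reached, so it separates these iterates. *)
Lemma uniq_traject_depth n x : n <= (depth x).+1 -> uniq (traject f x n).
Proof.
move=> le_n; apply: (@map_uniq _ _ depth).
rewrite (_ : map _ _ = map (subn (depth x)) (iota 0 n)).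
  rewrite map_inj_in_uniq ?iota_uniq // => i j; rewrite !mem_iota; lia.
apply: (@eq_from_nth _ 0) => [|i]; first by rewrite !size_map size_traject size_iota.
rewrite size_map size_traject => lt_i.
rewrite (nth_map x) ?size_traject // (nth_map 0) ?size_iota //.
by rewrite nth_traject // nth_iota // depth_iter.
Qed.

(** A walk from [x] meets no cyclic vertex before [entry x], so [u] lies on the cycle of
    [entry x]. *)
Lemma fconnect_entry x u : cyclic u -> fconnect f x u -> fconnect f u (entry x).
Proof.
move=> cu xu; apply: fconnect_cyclic_sym (entry_cyclic x) _.
have fu := iter_findex xu; have le_d : depth x <= findex f x u.
  by apply: depth_min; rewrite fu.
by rewrite -[u]fu -(subnK le_d) iterD fconnect_iter.
Qed.

End FunctionalGraph.

(** * Covering by peeling off removable pieces *)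

Section Covering.

Variables (T : finType) (f : T -> T) (U : {set T}) (q l : nat).
Hypotheses (l3 : 3 <= l) (lq : 2 * l <= q + 3).
Hypothesis alternate : forall v, (f v \in U) = (v \notin U).
Hypothesis girth : forall u, cyclic f u -> l <= order f u.

Definition covers (P B : {set T}) : Prop :=
  forall v, v \in B -> exists2 i, i <= q & iter i f v \in P.

(* B can be removed from A together with its cover P: the rest stays closed
   under f, and P is paid for by the vertices of B. *)
Definition removable (A P B : {set T}) : Prop :=
  [/\ [/\ B \subset A, B != set0 & {in A, forall v, f v \in B -> v \in B}],
      P \subset U, l * #|P| <= #|B| & covers P B].

Definition descendants (A : {set T}) (u : T) : {set T} :=
  [set v in A | fconnect f v u].

Lemma descendants_closed (A : {set T}) u :
  {in A, forall v, f v \in descendants A u -> v \in descendants A u}.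
Proof.
move=> v vA; rewrite !inE vA => /andP[_]; apply: connect_trans.
by apply: connect1; rewrite /= eqxx.
Qed.

Lemma mem_iter_U i v : (iter i f v \in U) = odd i (+) (v \in U).
Proof. by elim: i => //= i IHi; rewrite alternate IHi addNb. Qed.

Lemma odd_order_cyclic u : cyclic f u -> ~~ odd (order f u).
Proof.
move=> /iter_order_cyclic fu; have := mem_iter_U (order f u) u.
by rewrite fu; case: odd; case: (u \in U).
Qed.

Lemma removable_deep (A : {set T}) v :
  {in A, forall x, f x \in A} -> v \in A ->
  {in A, forall x, depth f x <= depth f v} ->
  l + (entry f v \in U) <= depth f v ->
  exists P B, removable A P B.
Proof.
move=> fA vA max_v deep.
have itA i : iter i f v \in A by elim: i => //= i /fA.
(* By alternation one of [l - 1] and [l] lands in [U]. If the depth is exactly [l], the entry is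
   outside [U], so it is [l - 1]. *)
have [i [le_i le_il lt_i iU]] : exists i,
    [/\ l <= i.+1, i <= l, i < depth f v & iter i f v \in U].
  have := mem_iter_U (depth f v) v; rewrite -/(entry f v) => EU.
  case lU: (iter l.-1 f v \in U); first by exists l.-1; split=> //; lia.
  exists l; rewrite mem_iter_U; rewrite mem_iter_U in lU.
  split; lia.
set u := iter i f v in iU.
exists [set u], (descendants A u).
have vD : v \in descendants A u by rewrite inE vA fconnect_iter.
split; last 1 first.
(* As [i < depth f v], [u] is off the cycle, so the distance from [x] to [u] is a difference of
   depths, at most [i] by maximality of [v]. *)
- move=> x; rewrite inE => /andP[xA xu]; exists (findex f x u).
    have := depth_iter f (findex f x u) x; rewrite (iter_findex xu) depth_iter.
    have := max_v x xA; lia.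
  by rewrite (iter_findex xu) set11.
- split; first by apply/subsetP=> x; rewrite inE => /andP[].
    by apply/set0Pn; exists v.
  exact: descendants_closed.
- by rewrite sub1set.
rewrite cards1 muln1; apply: (leq_trans le_i).
rewrite -(size_traject f v i.+1) cardE; apply: uniq_leq_size.
  by apply: uniq_traject_depth; lia.
move=> x /trajectP[j lt_j ->]; rewrite mem_enum inE itA /=.
by rewrite /u -(subnK (ltnSE lt_j)) iterD fconnect_iter.
Qed.

(** The pairs are ordered to end at [u]; the disjunction makes the last pair weigh at least 3, or
    every pair exactly 2, as [block_selection] requires. *)
Lemma removable_component (A : {set T}) u :
  {in A, forall x, f x \in A} -> u \in A -> u \in U -> cyclic f u ->
  {in A, forall x, depth f x + (entry f x \notin U) <= q} ->
  (exists2 x, x \in A & 0 < depth f x /\ (entry f x = u \/ f (entry f x) = u)) \/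
    {in A, forall x, depth f x = 0} ->
  exists P B, removable A P B.
Proof.
move=> fA uA uU cu shallow heavy.
set B := descendants A u; set c := order f u.
have fcu : iter c f u = u by apply: iter_order_cyclic.
have lc : l <= c by apply: girth.
have ec : c = c./2.*2 by rewrite even_halfK // odd_order_cyclic.
set m := c./2 in ec.
(* Indexed so that the selectable vertex u of the cycle is the last one, g c.-1;
   the members of U have odd indices. *)
pose g i := iter i.+1 f u.
have gA i : g i \in A by rewrite /g; elim: i.+1 => //= k /fA.
have gcyc i : cyclic f (g i) by apply: cyclic_iter.
have gB i : g i \in B.
  rewrite inE gA; apply: fconnect_cyclic_sym => //; exact: fconnect_iter.
have g_inj i j : i < c -> j < c -> g i = g j -> i = j.
  have gE k : k < c -> f (nth u (orbit f u) k) = g k.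
    by move=> lt_k; rewrite nth_traject.
  have sz : size (orbit f u) = c by rewrite size_orbit.
  move=> lt_i lt_j; rewrite -!gE // => /((orbitPcycle 2 5).1 cu).
  rewrite !mem_nth ?sz // => /(_ isT isT)/eqP.
  by rewrite nth_uniq ?sz ?orbit_uniq // => /eqP.
have g_surj x : x \in B -> exists2 i, i < c & entry f x = g i.
  rewrite inE => /andP[_ /(fconnect_entry cu) ux].
  have := iter_findex ux; have := findex_max ux; rewrite -/c.
  case: (findex f u _) => [|j] lt_j <-; last by exists j => //; lia.
  by exists c.-1; rewrite /g; [lia | rewrite prednK ?fcu //; lia].
(* Size of the tree rooted at [g i], root included. *)
pose a i := #|[set x in B | entry f x == g i]|.
have a_depth x i : x \in B -> entry f x = g i -> depth f x < a i.
  move=> xB xi; rewrite -(size_traject f x (depth f x).+1) /a cardE.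
  apply: uniq_leq_size; first exact: uniq_traject_depth.
  move=> y /trajectP[j lt_j ->]; rewrite mem_enum inE entry_iter // xi eqxx andbT.
  move: xB; rewrite !inE => /andP[xA xu]; apply/andP; split.
    by elim: (j) => //= k /fA.
  have fxu := iter_findex xu; have le_j : j <= findex f x u.
    by apply: leq_trans (ltnSE lt_j) (depth_min _); rewrite fxu.
  by rewrite -[u]fxu -(subnK le_j) iterD fconnect_iter.
have a_gt0 i : 0 < a i.
  apply/card_gt0P; exists (g i); rewrite inE gB /=.
  by have := gcyc i; rewrite -depth_eq0 /entry => /eqP->.
pose S n := \sum_(i < n) a i.
have SS n : S n.+1 = S n + a n by rewrite /S big_ord_recr.
have S_homo i k : k + S i <= S (i + k).
  by elim: k => [|k IHk]; rewrite ?addn0 // addnS SS; have := a_gt0 (i + k); lia.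
(* Double counting: [g] is injective below [c], so each vertex lies in at most one tree. *)
have S_B : S c <= #|B|.
  rewrite /S /a; under eq_bigr => i _ do rewrite -sum1dep_card big_mkcondr.
  rewrite exchange_big /= -sum1_card; apply: leq_sum => x _.
  rewrite -big_mkcond sum1dep_card; apply/card_le1_eqP => i j.
  by rewrite !inE => /eqP-> /eqP E; apply/val_inj/g_inj; rewrite ?ltn_ord.
have S_last : S m.-1.*2 + 3 <= S m.*2 \/ (forall i, i <= m -> S i.*2 = i.*2).
  case: heavy => [[x xA [x_gt0 xu]] | flat]; [left | right].
    have [m' em] : {m' | m = m'.+1} by exists m.-1; lia.
    have gu : g m'.*2.+1 = u by rewrite /g -doubleS -em -ec.
    rewrite em /= doubleS !SS.
    have xB : x \in B.
      rewrite inE xA; apply: (@connect_trans _ _ (entry f x)).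
        exact: fconnect_iter.
      by case: xu => <-; rewrite ?connect0 ?fconnect1.
    case: xu => xu.
      have := a_gt0 m'.*2; have := a_depth x m'.*2.+1 xB; rewrite gu => /(_ xu); lia.
    have := a_gt0 m'.*2.+1; have := a_depth x m'.*2 xB.
    have -> : entry f x = g m'.*2.
      rewrite /g -{1}xu -iterSr -doubleS -em -ec /c -xu.
      by rewrite order_step_cyclic ?iter_order_cyclic ?entry_cyclic.
    by move=> /(_ erefl); lia.
  have a1 i : a i = 1.
    apply/eqP/cards1P; exists (g i); apply/setP => x; rewrite !inE.
    apply/andP/eqP => [[/andP[xA _] /eqP<-] | ->].
      by rewrite /entry flat.
    by have := gB i; rewrite inE /entry flat.
  by move=> i _; rewrite /S; under eq_bigr do rewrite a1; rewrite sum1_card card_ord.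
have [|||P szP domP] := @block_selection l m (fun p => S p.*2) l3 _ _ _ S_last.
- lia.
- by move=> i j ij; have := S_homo i.*2 (j - i).*2; rewrite -doubleD subnKC //; lia.
- by rewrite -ec; have := S_homo 0 c; rewrite add0n; lia.
exists [set g (val p).*2.+1 | p in P], B; split.
- split; first by apply/subsetP=> x; rewrite inE => /andP[].
    by apply/set0Pn; exists (g 0).
  exact: descendants_closed.
- apply/subsetP=> _ /imsetP[p _ ->].
  by rewrite /g -doubleS mem_iter_U odd_double.
- have := leq_imset_card (fun p : 'I_m => g (val p).*2.+1) (mem P).
  move: szP; rewrite -ec => szP le_im; apply: leq_trans S_B; apply: leq_trans szP.
  by rewrite leq_mul2l le_im orbT.
move=> x xB; have [i lt_i xi] := g_surj x xB.
have [p' p'P [le_p dist_p]] := domP i./2 ltac:(lia).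
have le_i : i <= p'.*2.+1 by lia.
exists (p'.*2.+1 - i + depth f x); last first.
  rewrite iterD -/(entry f x) xi /g -iterD.
  by rewrite addnS subnK //; apply/imsetP; exists p'.
(* Within the selected pair, [shallow] bounds the distance. Otherwise [depth f x < a i] and each
   cycle vertex in between weighs at least 1, so the distance is at most
   [S p'.*2 - S i./2.*2 + 1 <= 2 * l - 3]. *)
case: (ltnP i./2 p') => [lt_p | ge_p]; last first.
  have xA : x \in A by move: xB; rewrite inE => /andP[].
  have := shallow x xA; rewrite xi /g mem_iter_U uU; lia.
have le_i' : i./2.*2 <= i by lia.
have := S_homo i./2.*2 (i - i./2.*2); rewrite subnKC // => S_i.
have := S_homo i.+1 (p'.*2 - i.+1); rewrite subnKC ?SS; last by lia.
have := a_depth x i xB xi; lia.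
Qed.

Lemma removable_exists (A : {set T}) :
  {in A, forall x, f x \in A} -> A != set0 -> exists P B, removable A P B.
Proof.
move=> fA /set0Pn[x0 x0A].
have itA i x : x \in A -> iter i f x \in A by move=> xA; elim: i => //= i /fA.
case: (arg_maxnP (depth f) x0A) => v vA max_v.
have [deep | shallow] := boolP [exists x in A,
    (depth f x == depth f v) && (l + (entry f x \in U) <= depth f x)].
  case/exists_inP: deep => x xA /andP[/eqP xv deep].
  by apply: (removable_deep fA xA) deep => y yA; rewrite xv; apply: max_v.
(* The sum is in fact at most [l]: a vertex below maximal depth has depth less than [l], which
   leaves room for the extra step. *)
have shallow' : {in A, forall x, depth f x + (entry f x \notin U) <= q}.
  move=> x xA; move/exists_inPn: shallow => sh.
  have := max_v x xA; have := sh x xA; have := sh v vA.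
  rewrite eqxx /=; case: eqVneq; lia.
(* With a tree present, the final vertex [u] is its root or the next iterate, whichever lies in [U],
   so that the last pair contains the root. *)
have [/exists_inP[x xA x_gt0] | flat] := boolP [exists x in A, 0 < depth f x].
  have eA : entry f x \in A by apply: itA.
  have [eU | eNU] := boolP (entry f x \in U).
    apply: (removable_component fA eA) => //; first exact: entry_cyclic.
    by left; exists x => //; split=> //; left.
  apply: (removable_component fA (fA _ eA)) => //; first by rewrite alternate.
    exact/cyclic_step/entry_cyclic.
  by left; exists x => //; split=> //; right.
have flat' : {in A, forall x, depth f x = 0}.
  by move=> x xA; move/exists_inPn/(_ x xA): flat; lia.
have cyc x : x \in A -> cyclic f x by move=> xA; rewrite -depth_eq0 flat'.
have [xU | xNU] := boolP (x0 \in U).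
  by apply: (removable_component fA x0A) => //; [apply: cyc | right].
apply: (removable_component fA (fA _ x0A)) => //; first by rewrite alternate.
  exact/cyclic_step/cyc.
by right.
Qed.

(** Induction on the size of [A]: removing [B] keeps stability under [f], and the costs add up. *)
Lemma small_cover (A : {set T}) : {in A, forall x, f x \in A} ->
  exists P : {set T}, [/\ P \subset U, l * #|P| <= #|A| & covers P A].
Proof.
have [n] := ubnP #|A|; elim: n A => // n IHn A; rewrite ltnS => leAn fA.
have [-> | A0] := eqVneq A set0.
  by exists set0; rewrite sub0set cards0 muln0; split=> // v; rewrite inE.
have [P [B [[BA B0 Bclosed] PU szP covP]]] := removable_exists fA A0.
have cardAB : #|A| = #|B| + #|A :\: B|.
  by rewrite -(cardsID B A) (setIidPr BA).
have B_gt0 : 0 < #|B| by rewrite card_gt0.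
have [||Q [QU szQ covQ]] := IHn (A :\: B).
- by lia.
- by move=> x /setDP[xA xB]; rewrite inE fA // andbT; apply: contra xB; apply: Bclosed.
exists (P :|: Q); split; first by rewrite subUset PU.
  have : #|P :|: Q| <= #|P| + #|Q| by rewrite cardsU leq_subr.
  rewrite -(leq_pmul2l (_ : 0 < l)) ?mulnDr; lia.
move=> v vA; have [vB | vNB] := boolP (v \in B).
  by have [i le_i iP] := covP v vB; exists i; rewrite // inE iP.
have [|i le_i iQ] := covQ v; first by rewrite inE vNB.
by exists i; rewrite // inE iQ orbT.
Qed.

End Covering.

(** * From iterates to distances in the digraph *)

Lemma is_set_dist_walk (T : finType) (e : rel T) (Q : {set T}) u v p :
  u \in Q -> path e u p -> last u p = v ->
  exists2 d, is_set_dist e Q v d & d <= size p.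
Proof.
move=> uQ up pv.
(* Tuples make walks of a given length decidable; a shortest walk from [Q], once shortened to a
   path, keeps its length by minimality. *)
pose reach d := [exists w in Q, exists s : d.-tuple T, path e w s && (last w s == v)].
have reachP w s : w \in Q -> path e w s -> last w s = v -> reach (size s).
  move=> wQ ws sv; apply/exists_inP; exists w => //; apply/existsP.
  by exists (in_tuple s); rewrite /= ws sv eqxx.
have ex : exists d, reach d by exists (size p); apply: reachP up pv.
case: (ex_minnP ex) => d /exists_inP[w wQ /existsP[s /andP[ws /eqP sv]]] min_d.
exists d; last by apply: min_d; apply: reachP up pv.
split; last first.
  move=> w' k w'Q [[s' [w's' s'v _] <-] _]; exact/min_d/(reachP w').
exists w => //; split; last by move=> s' [ws' s'v _]; exact/min_d/(reachP w).
move: sv; case: (shortenP ws) => s' ws' us' sub sv.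
exists s'; first by split.
apply/eqP; rewrite eqn_leq (min_d _ (reachP w s' wQ ws' _)) ?andbT //.
by rewrite -[X in _ <= X](size_tuple s) uniq_leq_size //; case/andP: us'.
Qed.

Lemma path_rev_traject (T : finType) (e : rel T) (f : T -> T) i v :
  (forall x, e (f x) x) ->
  exists2 p, path e (iter i f v) p /\ last (iter i f v) p = v & size p = i.
Proof.
move=> ef; elim: i v => [|i IHi] v; first by exists [::].
have [p [ep lp] sp] := IHi (f v); rewrite iterSr.
exists (rcons p v); last by rewrite size_rcons sp.
by rewrite rcons_path ep lp last_rcons /= ef.
Qed.

Theorem theorem2p7 (T : finType) (e : rel T) (U V : {set T}) (q l : nat)
    (hsf : source_free e) (hbip : bipartition e U V)
    (hq : 3 <= q) (hl : 3 <= l) (hlq : 2 * l <= q + 3)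
    (hcyc : forall c : seq T, dicycle e c -> l <= size c) :
  exists Q : {set T},
    [/\ q_kernel e q Q, l * #|Q| <= #|T| & Q \subset U].
Proof.
have [f ef] : exists f : T -> T, forall v, e (f v) v.
  have ex v : exists u, e u v by apply: hsf.
  by exists (fun v => xchoose (ex v)) => v; exact: xchooseP (ex v).
have [_ disUV arc] := hbip.
have UV x : x \in U -> x \in V -> False.
  by move=> xU xV; have := disjointFr disUV xU; rewrite xV.
have alternate v : (f v \in U) = (v \notin U).
  case: (arc _ _ (ef v)) => [[fU vV] | [fV vU]]; first rewrite fU; apply/esym.
    by apply/negP => /UV; apply.
  by rewrite vU; apply/esym/negP => /UV; apply.
have girth u : cyclic f u -> l <= order f u.
  (* Since [f] runs against the arcs, the reversed orbit is a directed cycle. *)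
  move=> cu; rewrite -size_orbit -size_rev; apply: hcyc; split.
    by move/(congr1 size); rewrite size_rev size_orbit; have := order_gt0 f u; case: order.
  rewrite /ucycle rev_cycle rev_uniq orbit_uniq andbT.
  have := (orbitPcycle 2 0).1 cu; apply: sub_cycle => x y /eqP <-; exact: ef.
have [Q [QU szQ covQ]] := small_cover hl hlq alternate girth (A := [set: T]) (fun _ _ => in_setT _).
exists Q; split=> //; last by rewrite -cardsT.
split.
  move=> x y /(subsetP QU) xU /(subsetP QU) yU; apply/negP => /arc.
  by case=> [[_ /(UV _ yU)] | [/(UV _ xU)]].
move=> v; have [i le_i iQ] := covQ v (in_setT v).
have [p [ep lp] sp] := path_rev_traject i v ef.
have [d dd le_d] := is_set_dist_walk iQ ep lp.
by exists d => //; rewrite (leq_trans le_d) ?sp.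
Qed.
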